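(* Let $n>0$. The Galois graph of the Hochschild lattice $\mathrm{Hoch}(n)$ is isomorphic (as a directed graph) to the directed graph $(V,E)$ with vertex set $V=\{(1,1),(1,2),\ldots,(1,n),(2,2),(2,3),\ldots,(2,n)\}$ which has an edge $(s,t)\to(s',t')$ if and only if $(s,t)\neq(s',t')$ and either ($s=2$, $s'=1$ and $t=t'$) or ($s=s'=1$ and $t>t'$).
   Context: Hochschild lattice. For $n\geq 1$ let $[n]=\{1,\ldots,n\}$. A triword of length $n$ is a tuple $u=(u_1,\ldots,u_n)$ such that (T1) $u_i\in\{0,1,2\}$ for all $i$; (T2) $u_1\neq 2$; (T3) if $u_i=0$, then $u_j\neq 1$ for all $j>i$. Let $\mathrm{Tri}(n)$ be the set of all triwords of length $n$. The Hochschild lattice is $\mathrm{Hoch}(n)=(\mathrm{Tri}(n),\leq)$ where $\leq$ is the componentwise order. It is known to be a lattice: the join is the componentwise maximum, and the meet is obtained by taking the componentwise minimum and then replacing by $0$ every entry $1$ that has an entry $0$ somewhere to its left. It is also known to be extremal. Extremal lattices and Galois graphs. Let $L$ be a finite lattice. An element is join irreducible if it covers exactly one element, and meet irreducible if it is covered by exactly one element. The length of $L$ is one less than the maximum cardinality of a chain. $L$ is extremal if the number of join-irreducible elements, the number of meet-irreducible elements and the length of $L$ all coincide. If $L$ is extremal of length $k$ and $\hat 0=a_0\lessdot a_1\lessdot\cdots\lessdot a_k=\hat 1$ is a maximal chain of length $k$, then the join-irreducible elements $j_1,\ldots,j_k$ and the meet-irreducible elements $m_1,\ldots,m_k$ can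 be labeled such that for all $s\in[k]$: $j_1\vee j_2\vee\cdots\vee j_s=a_s=m_{s+1}\wedge m_{s+2}\wedge\cdots\wedge m_k$ (an empty meet is $\hat 1$). The Galois graph of $L$ is the directed graph with vertex set $[k]$ in which $s\to t$ is an edge if and only if $s\neq t$ and $j_s\not\leq m_t$. *)

(* Defs.v *)
From HB Require Import structures.
From mathcomp Require Import all_boot all_order.

Set Implicit Arguments.
Unset Strict Implicit.
Unset Printing Implicit Defensive.

Import Order.TTheory.

Local Open Scope nat_scope.

(* Positions are 0-based: [u i] is the letter u_(i+1). *)
Definition is_triword (n : nat) (u : {ffun 'I_n -> 'I_3}) : bool :=
  [forall i : 'I_n, (i == 0 :> nat) ==> (u i != 2 :> nat)] &&
  [forall i : 'I_n, forall j : 'I_n,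
     (i < j) && (u i == 0 :> nat) ==> (u j != 1 :> nat)].

Record triword (n : nat) : Type := Triword {
  letters :> {ffun 'I_n -> 'I_3};
  lettersP : is_triword letters
}.

HB.instance Definition _ (n : nat) := [isSub for @letters n].
HB.instance Definition _ (n : nat) := [Finite of triword n by <:].

Lemma triword2 n (u : triword n) (i : 'I_n) : i = 0 :> nat -> u i < 2.
Proof.
move=> i0; have /andP[/forallP/(_ i) + _] := lettersP u.
by rewrite i0 eqxx /=; case: (u i) => [[|[|[|]]]].
Qed.

Lemma triword3 n (u : triword n) (i j : 'I_n) :
  i < j -> u i = 0 :> nat -> u j <> 1 :> nat.
Proof.
move=> ij ui; have /andP[_ /forallP/(_ i)/forallP/(_ j)] := lettersP u.
by rewrite ij ui /= => /eqP.
Qed.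

Lemma is_triwordI n (u : {ffun 'I_n -> 'I_3}) :
  (forall i : 'I_n, i = 0 :> nat -> u i < 2) ->
  (forall i j : 'I_n, i < j -> u i = 0 :> nat -> u j <> 1 :> nat) ->
  is_triword u.
Proof.
move=> u2 u3; apply/andP; split.
  by apply/forallP => i; apply/implyP => /eqP/u2; rewrite ltn_neqAle => /andP[].
apply/forallP => i; apply/forallP => j; apply/implyP => /andP[ij /eqP ui].
by apply/eqP; exact: (u3 i j).
Qed.

Fact hoch_display : Order.disp_t. Proof. exact: Order.Disp tt tt. Qed.

Definition triword_le (n : nat) (u v : triword n) : bool :=
  [forall i : 'I_n, u i <= v i].

Fact triword_le_refl n : reflexive (@triword_le n).
Proof. by move=> u; apply/forallP. Qed.

Fact triword_le_anti n : antisymmetric (@triword_le n).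
Proof.
move=> u v /andP[/forallP uv /forallP vu]; apply/val_inj/ffunP => i.
by apply/val_inj/eqP; rewrite eqn_leq uv vu.
Qed.

Fact triword_le_trans n : transitive (@triword_le n).
Proof.
move=> v u w /forallP uv /forallP vw; apply/forallP => i.
exact: leq_trans (uv i) (vw i).
Qed.

HB.instance Definition _ (n : nat) :=
  Order.Le_isPOrder.Build hoch_display (triword n)
    (@triword_le_refl n) (@triword_le_anti n) (@triword_le_trans n).

Lemma leEtriword n (u v : triword n) :
  (u <= v)%O = [forall i : 'I_n, u i <= v i].
Proof. by []. Qed.

Definition letter_max (a b : 'I_3) : 'I_3 := if a <= b then b else a.
Definition letter_min (a b : 'I_3) : 'I_3 := if a <= b then a else b.

Lemma letter_maxE a b : letter_max a b = maxn a b :> nat.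
Proof. by rewrite /letter_max; case: leqP. Qed.

Lemma letter_minE a b : letter_min a b = minn a b :> nat.
Proof. by rewrite /letter_min; case: leqP. Qed.

Definition join_letters n (u v : triword n) : {ffun 'I_n -> 'I_3} :=
  [ffun i => letter_max (u i) (v i)].

Definition meet_letters n (u v : triword n) : {ffun 'I_n -> 'I_3} :=
  [ffun i => if (letter_min (u i) (v i) == 1 :> nat) &&
                [exists k : 'I_n, (k < i) && (letter_min (u k) (v k) == 0 :> nat)]
             then ord0 else letter_min (u i) (v i)].

Fact join_lettersP n (u v : triword n) : is_triword (join_letters u v).
Proof.
apply: is_triwordI => [i i0|i j ij].
  by rewrite ffunE letter_maxE gtn_max !triword2.
rewrite !ffunE !letter_maxE => /eqP; rewrite -leqn0 geq_max !leqn0.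
move=> /andP[/eqP ui /eqP vi]; rewrite /maxn; case: ifP => _.
  exact: triword3 ij vi.
exact: triword3 ij ui.
Qed.

Fact meet_lettersP n (u v : triword n) : is_triword (meet_letters u v).
Proof.
apply: is_triwordI => [i i0|i j ij].
  rewrite ffunE; case: ifP => // _; rewrite letter_minE gtn_min.
  by rewrite triword2.
rewrite !ffunE => mi0.
have [k kj mk0] : exists2 k : 'I_n, k < j & letter_min (u k) (v k) = 0 :> nat.
  case: ifP mi0 => [/andP[_ /existsP[k /andP[ki /eqP mk0]]] _|_ mi0].
    by exists k => //; exact: ltn_trans ki ij.
  by exists i.
have [mj1|mj1] := eqVneq (letter_min (u j) (v j) : nat) 1; last first.
  by move=> /= e; rewrite e in mj1.
have -> : [exists k : 'I_n, (k < j) && (letter_min (u k) (v k) == 0 :> nat)].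
  by apply/existsP; exists k; rewrite kj mk0.
by [].
Qed.

Definition triword_join n (u v : triword n) : triword n :=
  Triword (join_lettersP u v).
Definition triword_meet n (u v : triword n) : triword n :=
  Triword (meet_lettersP u v).

Fact triword_meetP n (w u v : triword n) :
  (w <= triword_meet u v)%O = (w <= u)%O && (w <= v)%O.
Proof.
rewrite !leEtriword; apply/forallP/andP => [wuv|[/forallP wu /forallP wv] i].
  have wmin i : w i <= minn (u i) (v i).
    apply: leq_trans (wuv i) _; rewrite ffunE; case: ifP => //= _.
    by rewrite letter_minE.
  by split; apply/forallP => i; have := wmin i; rewrite leq_min => /andP[].
rewrite ffunE; have wi : w i <= letter_min (u i) (v i).
  by rewrite letter_minE leq_min wu wv.
case: ifP => // /andP[/eqP mi1 /existsP[k /andP[ki /eqP mk0]]].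
have wk0 : w k = 0 :> nat.
  have : w k <= letter_min (u k) (v k) by rewrite letter_minE leq_min wu wv.
  by rewrite [X in _ <= X]mk0 leqn0 => /eqP.
have := triword3 ki wk0; rewrite mi1 in wi.
by case: (w i : nat) wi => [|[|]].
Qed.

Fact triword_joinP n (u v w : triword n) :
  (triword_join u v <= w)%O = (u <= w)%O && (v <= w)%O.
Proof.
rewrite !leEtriword; apply/forallP/andP => [uvw|[/forallP uw /forallP vw] i].
  by split; apply/forallP => i; have := uvw i;
    rewrite ffunE letter_maxE geq_max => /andP[].
by rewrite ffunE letter_maxE geq_max uw vw.
Qed.

HB.instance Definition _ (n : nat) :=
  Order.POrder_MeetJoin_isLattice.Build hoch_display (triword n)
    (@triword_meetP n) (@triword_joinP n).

Definition bot_letters n : {ffun 'I_n -> 'I_3} := [ffun=> ord0].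
Definition top_letters n : {ffun 'I_n -> 'I_3} :=
  [ffun i : 'I_n => if i == 0 :> nat then inord 1 else inord 2].

Fact bot_lettersP n : is_triword (bot_letters n).
Proof. by apply: is_triwordI => [i _|i j _ _]; rewrite ffunE. Qed.

Fact top_lettersP n : is_triword (top_letters n).
Proof.
apply: is_triwordI => [i i0|i j ij]; rewrite !ffunE; first by rewrite i0 inordK.
by case: ifP => _; rewrite inordK.
Qed.

Fact triword_le0 n (u : triword n) : (Triword (bot_lettersP n) <= u)%O.
Proof. by apply/forallP => i; rewrite ffunE. Qed.

Fact triword_le1 n (u : triword n) : (u <= Triword (top_lettersP n))%O.
Proof.
apply/forallP => i; rewrite ffunE; case: ifP => [/eqP/(triword2 u)|_].
  by rewrite inordK.
by rewrite inordK // -ltnS ltn_ord.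
Qed.

HB.instance Definition _ (n : nat) :=
  Order.hasBottom.Build hoch_display (triword n) (@triword_le0 n).
HB.instance Definition _ (n : nat) :=
  Order.hasTop.Build hoch_display (triword n) (@triword_le1 n).

Definition hoch (n : nat) : finTBLatticeType hoch_display := triword n.

Definition covered_by d (L : finTBLatticeType d) (x y : L) : bool :=
  (x < y)%O && ~~ [exists z : L, (x < z)%O && (z < y)%O].

Definition join_irreducibles d (L : finTBLatticeType d) : {set L} :=
  [set x : L | #|[set y : L | covered_by y x]| == 1].

Definition meet_irreducibles d (L : finTBLatticeType d) : {set L} :=
  [set x : L | #|[set y : L | covered_by x y]| == 1].

Definition is_chain d (L : finTBLatticeType d) (C : {set L}) : bool :=
  [forall x in C, forall y in C, (x >=< y)%O].

Definition lattice_length d (L : finTBLatticeType d) : nat :=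
  (\max_(C : {set L} | is_chain C) #|C|).-1.

Definition extremal d (L : finTBLatticeType d) : Prop :=
  #|join_irreducibles L| = lattice_length L /\
  #|meet_irreducibles L| = lattice_length L.

(* The chain is a_0, ..., a_k, indexed by 'I_k.+1.  The irreducibles are indexed
   by 'I_k, the index [s] standing for the label s+1: thus [j s] is j_(s+1),
   [a (lift ord0 s)] is a_(s+1) and [a (widen_ord (leqnSn k) s)] is a_s. *)
Record galois_labelling d (L : finTBLatticeType d) (k : nat)
    (a : 'I_k.+1 -> L) (j m : 'I_k -> L) : Prop := GaloisLabelling {
  gl_extremal : extremal L;
  gl_length : k = lattice_length L;
  gl_bot : a ord0 = \bot%O;
  gl_top : a ord_max = \top%O;
  gl_cover : forall s : 'I_k,
    covered_by (a (widen_ord (leqnSn k) s)) (a (lift ord0 s));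
  gl_join_inj : injective j;
  gl_join_im : j @: [set: 'I_k] = join_irreducibles L;
  gl_meet_inj : injective m;
  gl_meet_im : m @: [set: 'I_k] = meet_irreducibles L;
  gl_joins : forall s : 'I_k,
    (\join_(t < k | (t <= s)%N) j t)%O = a (lift ord0 s);
  gl_meets : forall s : 'I_k,
    (\meet_(t < k | (s < t)%N) m t)%O = a (lift ord0 s)
}.

Definition galois_edge d (L : finTBLatticeType d) (k : nat) (j m : 'I_k -> L) :
    rel 'I_k :=
  fun s t => (s != t) && ~~ (j s <= m t)%O.

Definition digraph_iso (V W : Type) (e : rel V) (e' : rel W) : Prop :=
  exists f : V -> W, bijective f /\ forall x y : V, e x y = e' (f x) (f y).

(* Here the pairs (s, t) carry their actual (1-based) values. *)
Definition hoch_vertex (n : nat) : finType :=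
  {p : 'I_3 * 'I_n.+1 | (p.1 == 1 :> nat) && (1 <= p.2) ||
                        (p.1 == 2 :> nat) && (2 <= p.2)}.

Definition hoch_edge (n : nat) : rel (hoch_vertex n) :=
  fun p q =>
    let: (s, t) := val p in let: (s', t') := val q in
    (p != q) &&
    ([&& s == 2 :> nat, s' == 1 :> nat & t == t'] ||
     [&& s == 1 :> nat, s' == 1 :> nat & t' < t]).

(* Main.v *)
(** In a Galois labelling, j_s <= m_t whenever s < t, while j_s is never below
    m_s.  Hence the pairing of j_s with m_s does not depend on the maximal chain,
    and the Galois graph of an extremal lattice is unique up to isomorphism, so
    one labelling suffices.  In Hoch(n) the join irreducibles are the words
    1^i 0^(n-i) and the words with a single nonzero letter, equal to 2; the meet
    irreducibles are the words 1 2 ... 2 with one letter replaced by a smaller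
    one.  They label the chain which first writes the letters 1 and then turns
    all of them but the first into 2, both from left to right. *)
Require Import Defs.
From mathcomp Require Import all_boot all_order.
From mathcomp Require Import zify.

Set Implicit Arguments.
Unset Strict Implicit.
Unset Printing Implicit Defensive.

Import Order.TTheory.

Local Open Scope nat_scope.

(** * Irreducible elements of a finite lattice *)

Section FiniteLattice.
Variables (d : Order.disp_t) (L : finTBLatticeType d).
Implicit Types (x y z : L).

(** The size of the principal ideal serves as a rank: an element of a set that maximises it is
    maximal in that set. *)
Lemma lt_card_le x y :
  (x < y)%O -> #|[set t | (t <= x)%O]| < #|[set t | (t <= y)%O]|.
Proof.
move=> xy; apply: proper_card; apply/properP; split.
  by apply/subsetP => t; rewrite !inE => /le_trans; apply; exact: ltW.
by exists y; rewrite !inE ?lexx// lt_geF.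
Qed.

Lemma exists_lower_cover z x : (z < x)%O -> exists2 c, covered_by c x & (z <= c)%O.
Proof.
move=> zx; have Pz : (z <= z < x)%O by rewrite lexx.
case: (@arg_maxnP _ z (fun c => (z <= c < x)%O)
  (fun c : L => #|[set t : L | (t <= c)%O]|) Pz) => c /andP[zc cx] cmax.
exists c => //; rewrite /covered_by cx /=; apply/negP => /existsP[w /andP[cw wx]].
have := cmax w; rewrite (le_trans zc (ltW cw)) wx => /(_ isT).
by rewrite /= leqNgt lt_card_le.
Qed.

(** In a finite lattice everything strictly below [x] lies under a lower cover, so a unique lower
    cover is the greatest element strictly below [x]. *)
Lemma join_irreducibleP x :
  reflect (exists2 y, (y < x)%O & forall z, (z < x)%O -> (z <= y)%O)
    (x \in join_irreducibles L).
Proof.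
rewrite inE; apply: (iffP cards1P) => [[y Sy]|[y yx ymax]]; exists y.
- have : y \in [set y] by rewrite inE.
  by rewrite -Sy inE => /andP[].
- move=> z /exists_lower_cover[c cx zc].
  by have : c \in [set y] by [rewrite -Sy inE]; rewrite inE => /eqP <-.
apply/setP => z; rewrite !inE; apply/andP/eqP => [[zx /existsPn nz]|->].
  apply/eqP; rewrite eq_le ymax//=; have := nz y.
  by rewrite yx andbT lt_neqAle ymax// andbT negbK => /eqP ->.
by split=> //; apply/existsPn => w; apply/andP => -[yw /ymax]; rewrite lt_geF.
Qed.

End FiniteLattice.

Lemma meet_irreducibleP d (L : finTBLatticeType d) (x : L) :
  reflect (exists2 y, (x < y)%O & forall z, (x < z)%O -> (y <= z)%O)
    (x \in meet_irreducibles L).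
Proof.
have -> : (x \in meet_irreducibles L) = (x \in join_irreducibles L^d).
  rewrite !inE; congr (_ == 1); apply: eq_card => y; rewrite !inE /covered_by.
  by congr (_ && ~~ _); apply: eq_existsb => z; rewrite andbC.
by apply: (iffP (@join_irreducibleP _ L^d x)) => -[y xy ymin]; exists y.
Qed.

(** If [x] is not bottom, an element [c] maximal among those not above [x] is meet irreducible:
    whatever lies strictly above [c] is above the join of [c] and [x]. *)
Lemma le_meet_irreducibles d (L : finTBLatticeType d) (x : L) :
  (forall y, y \in meet_irreducibles L -> (x <= y)%O) -> x = \bot%O.
Proof.
move=> xm; apply/eqP; rewrite -lex0; apply/negPn/negP => xn0.
case: (@arg_maxnP _ \bot%O (fun c => ~~ (x <= c)%O)
  (fun c : L => #|[set t : L | (t <= c)%O]|) xn0) => c xc cmax.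
suff /xm : c \in meet_irreducibles L by apply/negP.
apply/meet_irreducibleP; exists (c `|` x)%O.
  by rewrite lt_neqAle leUl andbT; apply: contra xc => /eqP ->; exact: leUr.
move=> z cz; rewrite leUx (ltW cz) /=; apply/negPn/negP => /cmax /=.
by rewrite leqNgt lt_card_le.
Qed.

(** * Independence of the Galois graph from the labelling *)

Section GaloisLabelling.
Variables (d : Order.disp_t) (L : finTBLatticeType d) (k : nat).
Variables (a : 'I_k.+1 -> L) (j m : 'I_k -> L).
Hypothesis lab : galois_labelling a j m.

(** The chain element [a (lift ord0 s)] lies in between. *)
Lemma galois_lt_le (s t : 'I_k) : s < t -> (j s <= m t)%O.
Proof.
move=> st; apply: (@le_trans _ _ (a (lift ord0 s))).
  by rewrite -(gl_joins lab); apply: (joins_sup (j := s) _).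
by rewrite -(gl_meets lab); apply: (meets_inf (j := t) _).
Qed.

(* Otherwise [a_s = a_(s-1) \/ j_s <= m_s], so [a_s <= a_(s-1)]; for [s = 1] the
   meet of all the [m_t] is [a_0 = \bot]. *)
Lemma galois_diag (s : 'I_k) : ~~ (j s <= m s)%O.
Proof.
apply/negP => js.
have /andP[alt _] := gl_cover lab s.
have am : (a (lift ord0 s) <= m s)%O.
  rewrite -(gl_joins lab); apply/joinsP => t; rewrite leq_eqVlt.
  by case/predU1P => [/ord_inj->//|]; exact: galois_lt_le.
have amt (t : 'I_k) : s <= t -> (a (lift ord0 s) <= m t)%O.
  rewrite leq_eqVlt => /predU1P[/ord_inj<-//|st].
  by rewrite -(gl_meets lab); apply: (meets_inf (j := t) _).
have : (a (lift ord0 s) <= a (widen_ord (leqnSn k) s))%O; last by rewrite lt_geF.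
case: (posnP s) => s0.
  rewrite (@le_meet_irreducibles _ _ (a (lift ord0 s))) ?le0x// => y.
  by rewrite -(gl_meet_im lab) => /imsetP[t _ ->]; apply: amt; rewrite s0.
have s1k : s.-1 < k by rewrite (leq_ltn_trans (leq_pred _)).
have -> : widen_ord (leqnSn k) s = lift ord0 (Ordinal s1k).
  by apply: val_inj; rewrite /= /bump /= add1n prednK.
rewrite -[X in (_ <= X)%O](gl_meets lab); apply/meetsP => t /=.
by rewrite prednK//; exact: amt.
Qed.

End GaloisLabelling.

(* The two labellings differ by permutations [f] of the join irreducibles and
   [g] of the meet irreducibles; as [j' (f s)] is not below [m' (g s)], we get
   [g s <= f s] for all [s], and a permutation that never exceeds another one is
   equal to it. *)
Lemma galois_graph_unique d (L : finTBLatticeType d) (k k' : nat)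
    (a : 'I_k.+1 -> L) (j m : 'I_k -> L) (a' : 'I_k'.+1 -> L) (j' m' : 'I_k' -> L) :
  galois_labelling a j m -> galois_labelling a' j' m' ->
  digraph_iso (galois_edge j m) (galois_edge j' m').
Proof.
move=> lab lab'; have kk : k' = k by rewrite (gl_length lab) (gl_length lab').
subst k'.
have /fin_all_exists[f fE] : forall s, exists u, j s = j' u.
  move=> s; have : j s \in join_irreducibles L by rewrite -(gl_join_im lab) imset_f.
  by rewrite -(gl_join_im lab') => /imsetP[u _ ->]; exists u.
have /fin_all_exists[g gE] : forall s, exists u, m s = m' u.
  move=> s; have : m s \in meet_irreducibles L by rewrite -(gl_meet_im lab) imset_f.
  by rewrite -(gl_meet_im lab') => /imsetP[u _ ->]; exists u.
have fI : injective f by move=> s t e; apply: (gl_join_inj lab); rewrite !fE e.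
have gI : injective g by move=> s t e; apply: (gl_meet_inj lab); rewrite !gE e.
have gf s : g s <= f s ?= iff (g s == f s).
  split=> //; rewrite leqNgt; apply/negP => /(galois_lt_le lab').
  by rewrite -fE -gE; exact/negP/(galois_diag lab).
have fg : g =1 f.
  (* Both sums run once over all labels, so they agree, and a termwise inequality with equal sums is
     an equality. *)
  have [_] := leqif_sum (fun s (_ : xpredT s) => gf s).
  rewrite -(reindex_inj gI (P := xpredT) (F := fun s : 'I_k => s : nat)).
  rewrite -(reindex_inj fI (P := xpredT) (F := fun s : 'I_k => s : nat)).
  by rewrite eqxx => /esym/forallP e s; exact/eqP/e.
exists f; split; first exact: injF_bij.
by move=> s t; rewrite /galois_edge (inj_eq fI) fE gE fg.
Qed.

(** * A criterion for Galois labellings *)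

Section Criterion.
Variables (d : Order.disp_t) (L : finTBLatticeType d) (k : nat).
Variables (a : 'I_k.+1 -> L) (j m : 'I_k -> L).
Hypothesis ja : forall t s, (j t <= a s)%O = (t < s).
Hypothesis am : forall s t, (a s <= m t)%O = (s <= t).
Hypothesis jdense : forall x y : L,
  (forall t, (j t <= x)%O -> (j t <= y)%O) -> (x <= y)%O.
Hypothesis mdense : forall x y : L,
  (forall t, (y <= m t)%O -> (x <= m t)%O) -> (x <= y)%O.
Hypothesis jirr : forall t, j t \in join_irreducibles L.
Hypothesis mirr : forall t, m t \in meet_irreducibles L.

Let jset (x : L) := [set t | (j t <= x)%O].

Lemma jset_sub x y : (jset x \subset jset y) = (x <= y)%O.
Proof.
apply/subsetP/idP => [xy|xy t]; last by rewrite !inE => /le_trans; apply.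
by apply: jdense => t jx; have := xy t; rewrite !inE; apply.
Qed.

Lemma labelling_le s t : (a s <= a t)%O = (s <= t).
Proof.
apply/idP/idP => [st|st].
  rewrite leqNgt; apply/negP => ts.
  have tk : t < k by apply: leq_trans ts _; rewrite -ltnS.
  have : (j (Ordinal tk) <= a s)%O by rewrite ja.
  by move=> /le_trans/(_ st); rewrite ja ltnn.
by apply: jdense => u; rewrite !ja => /leq_trans; apply.
Qed.

Lemma labelling_inj : injective a.
Proof.
by move=> s t e; apply/val_inj/eqP; rewrite /= eqn_leq -!labelling_le e lexx.
Qed.

(** By [ja], [t] is the last chain index whose element is not above [j t]. *)
Lemma labelling_join_inj : injective j.
Proof.
move=> s t e; apply/val_inj/eqP; rewrite /= eqn_leq.
apply/andP; split.
  have := ja s (lift ord0 t); rewrite e ja.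
  by rewrite lift0 ltnS leqnn => /esym; rewrite ltnS.
have := ja t (lift ord0 s); rewrite -e ja.
by rewrite lift0 ltnS leqnn => /esym; rewrite ltnS.
Qed.

Lemma labelling_meet_inj : injective m.
Proof.
move=> s t e; apply/val_inj/eqP; rewrite /= eqn_leq.
have := am (widen_ord (leqnSn k) s) t; rewrite -e am /= leqnn => <-.
by have := am (widen_ord (leqnSn k) t) s; rewrite e am /= leqnn => <-.
Qed.

(** If [x] is no [j t], every [j t] below [x] is below the greatest element [y] strictly below [x],
    and density gives [x <= y]. *)
Lemma labelling_join_im : j @: [set: 'I_k] = join_irreducibles L.
Proof.
apply/setP => x; apply/imsetP/idP => [[t _ ->]//|/join_irreducibleP[y yx ymax]].
have [/existsP[t /eqP ->]|/existsPn nx] := boolP [exists t, x == j t].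
  by exists t.
suff : (x <= y)%O by rewrite lt_geF.
by apply: jdense => t tx; apply: ymax; rewrite lt_neqAle tx eq_sym nx.
Qed.

Lemma labelling_meet_im : m @: [set: 'I_k] = meet_irreducibles L.
Proof.
apply/setP => x; apply/imsetP/idP => [[t _ ->]//|/meet_irreducibleP[y xy ymin]].
have [/existsP[t /eqP ->]|/existsPn nx] := boolP [exists t, x == m t].
  by exists t.
suff : (y <= x)%O by rewrite lt_geF.
by apply: mdense => t tx; apply: ymin; rewrite lt_neqAle tx nx.
Qed.

(* On a chain, [x] is determined by the number of [j t] below it. *)
Lemma labelling_length : lattice_length L = k.
Proof.
rewrite /lattice_length -[RHS]/(k.+1.-1); congr (_.-1); apply/eqP.
rewrite eqn_leq; apply/andP; split.
  apply/bigmax_leqP => C /forall_inP chC.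
  have jk (x : L) : #|jset x| < k.+1.
    by rewrite ltnS -[X in _ <= X](card_ord k) max_card.
  rewrite -[X in _ <= X](card_ord k.+1).
  rewrite -(@card_in_imset _ _ (fun x => Ordinal (jk x))) ?max_card//.
  move=> x y xC yC [cxy].
  have : (x >=< y)%O by exact: (forall_inP (chC x xC)).
  case/orP => xy; apply/eqP; rewrite eq_le xy ?andbT /=.
    by rewrite -jset_sub -(eqP (_ : jset x == jset y)) // eqEcard jset_sub xy cxy /=.
  by rewrite -jset_sub -(eqP (_ : jset y == jset x)) // eqEcard jset_sub xy cxy /=.
have chA : is_chain (a @: [set: 'I_k.+1]).
  apply/forall_inP => x /imsetP[s _ ->]; apply/forall_inP => y /imsetP[t _ ->].
  by rewrite /Order.comparable !labelling_le leq_total.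
apply: leq_trans (leq_bigmax_cond _ chA).
by rewrite card_imset ?cardsT ?card_ord//; exact: labelling_inj.
Qed.

Lemma galois_labelling_criterion : galois_labelling a j m.
Proof.
split.
- by rewrite /extremal -labelling_join_im -labelling_meet_im !card_imset
    ?cardsT ?card_ord ?labelling_length//;
    [exact: labelling_meet_inj|exact: labelling_join_inj].
- by rewrite labelling_length.
(* No [j t] is below [a ord0] and no [m t] is above [a ord_max], so the density hypotheses apply
   vacuously. *)
- by apply/eqP; rewrite -lex0; apply: jdense => t; rewrite ja.
- by apply/eqP; rewrite -le1x; apply: mdense => t; rewrite am leqNgt ltn_ord.
- move=> s; have als : (a (widen_ord (leqnSn k) s) < a (lift ord0 s))%O.
    by rewrite lt_leAnge !labelling_le lift0 /= leqnSn ltnn.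
  rewrite /covered_by als /=; apply/existsPn => z; apply/negP => /andP[sz zs].
  (* Among the [j t], only [j s] is below the upper element but not the lower one, so [j s <= z]
     decides which of the two [z] must be. *)
  have [jz|jz] := boolP (j s <= z)%O.
    suff : (a (lift ord0 s) <= z)%O by rewrite lt_geF.
    apply: jdense => t; rewrite ja lift0 ltnS leq_eqVlt.
    case/predU1P => [/ord_inj->//|ts].
    by apply: le_trans (ltW sz); rewrite ja.
  suff : (z <= a (widen_ord (leqnSn k) s))%O by rewrite lt_geF.
  apply: jdense => t tz; rewrite ja /= ltn_neqAle.
  have := le_trans tz (ltW zs); rewrite ja lift0 ltnS => ->; rewrite andbT.
  by apply: contra jz => /eqP/ord_inj <-.
- exact: labelling_join_inj.
- exact: labelling_join_im.
- exact: labelling_meet_inj.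
- exact: labelling_meet_im.
- move=> s; apply/eqP; rewrite eq_le; apply/andP; split.
    by apply/joinsP => t ts; rewrite ja lift0 ltnS.
  apply: jdense => t; rewrite ja lift0 ltnS => ts.
  exact: (joins_sup (j := t) _).
- move=> s; apply/eqP; rewrite eq_le; apply/andP; split; last first.
    by apply/meetsP => t ts; rewrite am lift0.
  apply: mdense => t; rewrite am lift0 => ts.
  exact: (meets_inf (j := t) _).
Qed.

End Criterion.

(** * Special words of the Hochschild lattice and their irreducibility *)

(* Outside the hypotheses of [wordE] this is the bottom element. *)
Definition word n (f : nat -> nat) : hoch n :=
  insubd (\bot%O : hoch n) [ffun i : 'I_n => inord (f i) : 'I_3].

Lemma wordE n (f : nat -> nat) (i : 'I_n) :
  (forall l, f l < 3) -> f 0 < 2 ->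
  (forall l l', l < l' -> f l = 0 -> f l' <> 1) -> word n f i = f i :> nat.
Proof.
move=> f3 f0 fT; rewrite /word /insubd insubT /= ?ffunE ?inordK//.
apply: is_triwordI => [l l0|l l' ll']; rewrite !ffunE !inordK// ?l0//.
exact: fT.
Qed.

Lemma hochP n (u v : hoch n) : reflect (forall i, u i <= v i) (u <= v)%O.
Proof. exact: forallP. Qed.

Lemma hoch_letter_lt3 n (u : hoch n) i : u i < 3.
Proof. exact: ltn_ord. Qed.

Lemma hoch_letter_gt0 n (u : hoch n) (i l : 'I_n) :
  l <= i -> u i = 1 :> nat -> 0 < u l.
Proof.
rewrite leq_eqVlt => /predU1P[/ord_inj->->//|li ui]; rewrite lt0n.
by apply/eqP => ul; exact: (@triword3 n u _ _ li ul ui).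
Qed.

Definition top_letter (l : nat) : nat := if l == 0 then 1 else 2.

Lemma hoch_le_top_letter n (u : hoch n) (i : 'I_n) : u i <= top_letter i.
Proof.
rewrite /top_letter; case: eqP => [i0|_]; last by rewrite -ltnS hoch_letter_lt3.
by rewrite -ltnS (@triword2 n u).
Qed.

Definition ones n (k : nat) : hoch n := word n (fun l => l < k).

Definition single_two n (i : nat) : hoch n := word n (fun l => (l == i).*2).

(** The minimum keeps the first letter below 2, so this is a triword for all [i] and [c]. *)
Definition capped_top n (i c : nat) : hoch n :=
  word n (fun l => if l == i then minn c (top_letter l) else top_letter l).

Lemma onesE n k (l : 'I_n) : ones n k l = (l < k) :> nat.
Proof.
apply: wordE => [{}l||{}l l'].
- by case: (l < k).
- by case: (0 < k).
- by move=> ll'; lia.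
Qed.

Lemma single_twoE n i (l : 'I_n) : 0 < i -> single_two n i l = (l == i :> nat).*2 :> nat.
Proof.
move=> i0; apply: wordE => [{}l||{}l l' _ _]; first by case: (l == i).
  by rewrite eq_sym eqn0Ngt i0.
by case: (l' == i).
Qed.

Lemma capped_topE n i c (l : 'I_n) : capped_top n i c l =
  (if l == i :> nat then minn c (top_letter l) else top_letter l) :> nat.
Proof.
apply: wordE => [{}l||{}l l' ll']; rewrite /top_letter.
- by case: (l == i); case: (l == 0); lia.
- by case: (0 == i) => /=; lia.
- by case: (l =P i) => ?; case: (l' =P i) => ?; case: (l =P 0); case: (l' =P 0); lia.
Qed.

Lemma ones_leP n (u : hoch n) k :
  reflect (forall l : 'I_n, l < k -> 0 < u l) (ones n k <= u)%O.
Proof.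
apply: (iffP (hochP _ _)) => ku l; first by move=> lk; have := ku l; rewrite onesE lk.
by rewrite onesE; case: ltnP => // /ku.
Qed.

Lemma single_two_le n (u : hoch n) (i : 'I_n) :
  0 < i -> (single_two n i <= u)%O = (1 < u i).
Proof.
move=> i0; apply/hochP/idP => [/(_ i)|ui l]; first by rewrite single_twoE// eqxx.
by rewrite single_twoE//; case: eqP => // /ord_inj ->.
Qed.

Lemma le_capped_top n (u : hoch n) (i : 'I_n) c :
  (u <= capped_top n i c)%O = (u i <= c).
Proof.
apply/hochP/idP => [/(_ i)|ui l]; rewrite capped_topE.
  by rewrite eqxx leq_min => /andP[].
by case: eqP => [/ord_inj ->|_]; rewrite ?leq_min ?ui hoch_le_top_letter.
Qed.

(** In a word below [ones n i.+1], a nonzero letter at position [i] is a 1 and forces nonzero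
    letters on its left, which gives the whole of [ones n i.+1]. So all words strictly below lie
    under [ones n i]. *)
Lemma ones_join_irreducible n (i : 'I_n) : ones n i.+1 \in join_irreducibles (hoch n).
Proof.
apply/join_irreducibleP; exists (ones n i).
  rewrite lt_leAnge; apply/andP; split.
    by apply/hochP => l; rewrite !onesE; lia.
  by apply/negP => /hochP/(_ i); rewrite !onesE ltnn ltnSn.
move=> z; rewrite lt_leAnge => /andP[/hochP zi /ones_leP niz].
have zi0 : z i = 0 :> nat.
  apply/eqP; rewrite -leqn0 leqNgt; apply/negP => zi0; apply: niz => l; rewrite ltnS => li.
  by apply: hoch_letter_gt0 li _; have := zi i; rewrite onesE ltnSn; lia.
apply/hochP => l; have := zi l; rewrite !onesE.
by have [->|] := eqVneq l i; [rewrite zi0|rewrite -val_eqE /=; lia].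
Qed.

(** As [0 < i], a word strictly below starts with 0, which excludes a letter 1 at position [i]; only
    the bottom is left. *)
Lemma single_two_join_irreducible n (i : 'I_n) :
  0 < i -> single_two n i \in join_irreducibles (hoch n).
Proof.
move=> i0; apply/join_irreducibleP; exists \bot%O.
  rewrite lt0x; apply/eqP => e; have := single_two_le \bot%O i0.
  by rewrite e lexx [LHS]/= ffunE.
move=> z; rewrite lt_leAnge single_two_le// => /andP[/hochP zi niz].
pose l0 := Ordinal (leq_ltn_trans (leq0n i) (ltn_ord i)).
have z0 : z l0 = 0 :> nat.
  by have := zi l0; rewrite single_twoE//=; case: eqP => /=; lia.
apply/hochP => l; have := zi l; rewrite single_twoE//.
case: eqP => [/ord_inj ->|_] /=; last by rewrite leqn0 => /eqP ->.
have : z i <> 1 :> nat by apply: (@triword3 n z l0 i).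
by lia.
Qed.

(** A word strictly above exceeds [c] at position [i], so it lies above the word with cap [c.+1]. *)
Lemma capped_top_meet_irreducible n (i : 'I_n) c :
  c < top_letter i -> capped_top n i c \in meet_irreducibles (hoch n).
Proof.
move=> ci; apply/meet_irreducibleP; exists (capped_top n i c.+1).
  by rewrite lt_leAnge !le_capped_top !capped_topE eqxx; lia.
move=> z; rewrite lt_leAnge le_capped_top -ltnNge => /andP[/hochP iz cz].
apply/hochP => l; have := iz l; rewrite !capped_topE; case: eqP => // /ord_inj -> _.
by rewrite geq_min cz.
Qed.

(** * The labelling of [hoch n.+1] *)

Section HochLabelling.
Variable n : nat.
Local Notation k := (n.+1 + n).

(** Letter [i] becomes 1 at index [i.+1] and, for positive [i], becomes 2 at index [n.+1 + i]. *)
Definition hoch_chain (s : 'I_k.+1) : hoch n.+1 :=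
  word n.+1 (fun i => (i < s) + ((0 < i) && (n.+1 + i <= s))).

(** The least word having the letter that step [t] of the chain writes. In the second case
    [lift ord0] skips the first position, which never carries a 2. *)
Definition hoch_join_irr (t : 'I_k) : hoch n.+1 :=
  match split t with
  | inl i => ones n.+1 i.+1
  | inr i => single_two n.+1 (lift ord0 i)
  end.

(** The greatest word in which the letter changed by step [t] still has its old value. *)
Definition hoch_meet_irr (t : 'I_k) : hoch n.+1 :=
  match split t with
  | inl i => capped_top n.+1 i 0
  | inr i => capped_top n.+1 (lift ord0 i) 1
  end.

Lemma hoch_chainE s (i : 'I_n.+1) :
  hoch_chain s i = (i < s) + ((0 < i) && (n.+1 + i <= s)) :> nat.
Proof.
by apply: wordE => [{}i||{}i l il] /=; lia.
Qed.

Lemma hoch_galois_labelling : galois_labelling hoch_chain hoch_join_irr hoch_meet_irr.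
Proof.
apply: galois_labelling_criterion.
- move=> t s; rewrite /hoch_join_irr; case: splitP => i ->.
    apply/ones_leP/idP => [/(_ i (ltnSn i))|ts l]; first by rewrite hoch_chainE; lia.
    by rewrite hoch_chainE ltnS => li; rewrite (leq_ltn_trans li ts).
  by rewrite single_two_le// hoch_chainE lift0; have := ltn_ord i; lia.
- move=> s t; rewrite /hoch_meet_irr; case: splitP => i ->.
    by rewrite le_capped_top hoch_chainE; lia.
  by rewrite le_capped_top hoch_chainE lift0; have := ltn_ord i; lia.
(* A letter 2 of [x] is detected by [single_two]; a letter 1 at [i] has only nonzero letters on its
   left, so [ones n.+1 i.+1] detects it. *)
- move=> x y xy; apply/hochP => i.
  have [|x1] := leqP (x i) 1; last first.
    case: (unliftP ord0 i) x1 => [l ->|->] x1; last first.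
      by have := hoch_le_top_letter x ord0; rewrite leqNgt x1.
    have := xy (rshift n.+1 l).
    rewrite /hoch_join_irr (unsplitK (inr _ l)) !single_two_le// => /(_ x1).
    by apply: leq_trans; rewrite -ltnS ltn_ord.
  case xi: (x i : nat) => [//|[|//]] _.
  have := xy (lshift n i).
  rewrite /hoch_join_irr (unsplitK (inl _ i)) => h.
  have /h/ones_leP/(_ i (ltnSn i))// : (ones n.+1 i.+1 <= x)%O.
  by apply/ones_leP => l; rewrite ltnS => /hoch_letter_gt0; exact.
(* Letters 0 and 1 of [y] bound those of [x] through the caps 0 and 1; a 1 in first position or a 2
   is already the largest possible letter. *)
- move=> x y yx; apply/hochP => i.
  have y0 : y i = 0 :> nat -> x i = 0 :> nat.
    have := yx (lshift n i).
    rewrite /hoch_meet_irr (unsplitK (inl _ i)) !le_capped_top !leqn0 => h /eqP.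
    by move=> /h/eqP.
  case yi: (y i : nat) => [|[|c]]; first by rewrite y0.
    case: (unliftP ord0 i) yi => [l ->|->] yi; last exact: hoch_le_top_letter.
    have := yx (rshift n.+1 l).
    by rewrite /hoch_meet_irr (unsplitK (inr _ l)) !le_capped_top yi; apply.
  by have := hoch_letter_lt3 x i; lia.
- move=> t; rewrite /hoch_join_irr; case: split => i.
    exact: ones_join_irreducible.
  exact: single_two_join_irreducible.
- move=> t; rewrite /hoch_meet_irr; case: split => i.
    by apply: capped_top_meet_irreducible; rewrite /top_letter; case: ifP.
  exact: capped_top_meet_irreducible.
Qed.

(** * The isomorphism with the explicit digraph *)

Lemma hoch_vertex_inl (i : 'I_n.+1) :
  ((inord 1 : 'I_3) == 1 :> nat) && (1 <= lift ord0 i) ||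
  ((inord 1 : 'I_3) == 2 :> nat) && (2 <= lift ord0 i).
Proof. by rewrite !inordK. Qed.

Lemma hoch_vertex_inr (i : 'I_n) :
  ((inord 2 : 'I_3) == 1 :> nat) && (1 <= lift ord0 (lift ord0 i)) ||
  ((inord 2 : 'I_3) == 2 :> nat) && (2 <= lift ord0 (lift ord0 i)).
Proof. by rewrite !inordK. Qed.

(** The outer [lift ord0] passes to 1-based positions; the inner one skips the first position. *)
Definition vertex_of_label (s : 'I_k) : hoch_vertex n.+1 :=
  match split s with
  | inl i => Sub (inord 1 : 'I_3, lift ord0 i) (hoch_vertex_inl i)
  | inr i => Sub (inord 2 : 'I_3, lift ord0 (lift ord0 i)) (hoch_vertex_inr i)
  end.

(** The vertex (2,t) has label [n.+1 + (t - 2)], that is [n + t.-1]; the value is always below [k],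
    so [inord] never takes its default. *)
Definition label_of_vertex (p : hoch_vertex n.+1) : 'I_k :=
  inord (((val p).1 == 2 :> nat) * n + (val p).2.-1).

Lemma label_inordK (l : nat) : l < k -> (inord l : 'I_k) = l :> nat.
Proof. exact: inordK. Qed.

Lemma vertex_of_labelK : cancel vertex_of_label label_of_vertex.
Proof.
move=> s; apply: ord_inj; rewrite /label_of_vertex /vertex_of_label.
by have := ltn_ord s; case: splitP => i si sk;
  rewrite SubK (@inordK 2)// label_inordK !lift0 /= ?mul1n ?mul0n; lia.
Qed.

Lemma label_of_vertexK : cancel label_of_vertex vertex_of_label.
Proof.
case=> [[s t] st]; apply: val_inj; rewrite /label_of_vertex /vertex_of_label SubK.
have /= t2 := ltn_ord t; have /= s2 := ltn_ord s; move: (st) => /= st'.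
have lk : ((s : nat) == 2) * n + t.-1 < k by case: eqP st' => s2'; lia.
case: splitP => i /=; rewrite label_inordK//;
  move=> it; congr (_, _); apply: ord_inj; rewrite /= ?inordK// /bump /=;
  have := ltn_ord i; move: it st'; case: eqP => s2'; lia.
Qed.

(** An edge means that one letter of [j s] exceeds the cap of [m t]. The word [ones n.+1 i.+1]
    exceeds the cap 0 at positions up to [i] and no cap 1; a single 2 exceeds both caps at its own
    position, where the cap 1 has the same label and gives no edge. *)
Lemma hoch_edge_label (s t : 'I_k) :
  galois_edge hoch_join_irr hoch_meet_irr s t =
  hoch_edge (vertex_of_label s) (vertex_of_label t).
Proof.
rewrite /galois_edge /hoch_edge (can_eq vertex_of_labelK).
rewrite /hoch_join_irr /hoch_meet_irr /vertex_of_label.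
by case: (splitP s) => i si; case: (splitP t) => l tl;
  rewrite le_capped_top ?onesE ?single_twoE// !SubK !inordK// -!val_eqE /= si tl /bump /=;
  lia.
Qed.

Lemma hoch_labelling_iso :
  digraph_iso (galois_edge hoch_join_irr hoch_meet_irr) (@hoch_edge n.+1).
Proof.
exists vertex_of_label; split; last exact: hoch_edge_label.
by exists label_of_vertex; [exact: vertex_of_labelK|exact: label_of_vertexK].
Qed.

End HochLabelling.

Lemma digraph_iso_trans (U V W : Type) (e : rel U) (e' : rel V) (e'' : rel W) :
  digraph_iso e e' -> digraph_iso e' e'' -> digraph_iso e e''.
Proof.
move=> [f [bf ef]] [g [bg eg]]; exists (g \o f); split; first exact: bij_comp.
by move=> x y; rewrite ef eg.
Qed.

Theorem theorem1p1 (n : nat) (hn : (0 < n)%N) :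
  (exists (k : nat) (a : 'I_k.+1 -> hoch n) (j m : 'I_k -> hoch n),
     galois_labelling a j m) /\
  (forall (k : nat) (a : 'I_k.+1 -> hoch n) (j m : 'I_k -> hoch n),
     galois_labelling a j m ->
     digraph_iso (galois_edge j m) (@hoch_edge n)).
Proof.
case: n hn => [//|n] _; have lab := hoch_galois_labelling n.
split; first by do 4!eexists; exact: lab.
move=> k a j m /galois_graph_unique/(_ lab)/digraph_iso_trans; apply.
exact: hoch_labelling_iso.
Qed.
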